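(* Let $m$ be a positive integer. The set of P-positions of $m$-Modular Wythoff's Game is exactly $\mathcal{P}_{a_m}$.
   Context: Let $\phi = \frac{1+\sqrt5}{2}$. $m$-Modular Wythoff's Game ($m$ a positive integer): a position is an ordered pair $(p_1,p_2)$ of nonnegative integers, the numbers of tokens in two piles. Two players alternate moves. The allowed moves are: (Type I) take any positive number of tokens from exactly one pile; (Type II) take a positive number $k_1$ of tokens from the first pile and a positive number $k_2$ of tokens from the second pile, provided $k_1 \equiv k_2 \pmod m$. (Pile sizes must remain nonnegative.) The player who cannot move, i.e. whose turn it is at $(0,0)$, loses. A P-position is a position from which the previous player (the one who just moved) has a winning strategy; an N-position is one from which the next player to move has a winning strategy. Equivalently, since the game always terminates: a position is a P-position if and only if every move from it leads to an N-position, and a position is an N-position if and only if some move from it leads to a P-position. The sets $\mathcal{P}_i$ ($i \ge 0$) of ordered pairs of nonnegative integers are defined recursively by $\mathcal{P}_0 = \{(0,0)\}$ and, for $i \ge 1$, $\mathcal{P}_i = \mathcal{P}_{i-1} \cup \{(c_i, c_i+i), (c_i+i, c_i)\}$, where $c_i$ is the smallest positive integer that is not a coordinate of any ordered pair in $\mathcal{P}_{i-1}$. For a positive integer $m$, $a_m = \lfloor m/\phi \rfloor$; equivalently, $a_m$ is the unique integer with $\lfloor a_m \phi\rfloor < m \le \lfloor (a_m+1)\phi\rfloor$. *)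

(* Defs.v *)
From HB Require Import structures.
From mathcomp Require Import all_boot all_order all_algebra.
From mathcomp Require Import finmap.
From mathcomp Require Import classical_sets reals.

Set Implicit Arguments.
Unset Strict Implicit.
Unset Printing Implicit Defensive.

Import Order.TTheory GRing.Theory Num.Theory.

Section Games.
Variables (T : Type) (move : T -> T -> Prop).

(* [wins_as_second sigma p]: the opponent is to move at [p], and the player who
   answers every move to [q] by moving to [sigma q] always makes a legal move
   and wins. Inductiveness forces every such play to be finite; it ends at a
   position where the opponent cannot move, and so loses. *)
Inductive wins_as_second (sigma : T -> T) (p : T) : Prop :=
  WinsAsSecond of
    (forall q, move p q -> move q (sigma q)) &
    (forall q, move p q -> wins_as_second sigma (sigma q)).

(* The player to win is the one who moved to [p]. *)
Definition P_position (p : T) : Prop := exists sigma, wins_as_second sigma p.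

End Games.

Inductive wythoff_move (m : nat) : nat * nat -> nat * nat -> Prop :=
| TakeFirst p1 p2 k of 0 < k & k <= p1 :
    wythoff_move m (p1, p2) (p1 - k, p2)
| TakeSecond p1 p2 k of 0 < k & k <= p2 :
    wythoff_move m (p1, p2) (p1, p2 - k)
| TakeBoth p1 p2 k1 k2 of 0 < k1 & k1 <= p1 & 0 < k2 & k2 <= p2
    & k1 = k2 %[mod m] :
    wythoff_move m (p1, p2) (p1 - k1, p2 - k2).

Local Open Scope fset_scope.

Definition coordinates (S : {fset nat * nat}) : {fset nat} :=
  [fset p.1 | p in S] `|` [fset p.2 | p in S].

Lemma fresh_exists (S : {fset nat * nat}) :
  exists c, (0 < c)%N && (c \notin coordinates S).
Proof.
exists (\max_(x <- coordinates S) x).+1; apply/negP => max_in.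
by have := @leq_bigmax_seq _ _ xpredT id _ max_in isT; rewrite ltnn.
Qed.

Definition fresh (S : {fset nat * nat}) : nat := ex_minn (fresh_exists S).

Fixpoint wythoff_pairs (i : nat) : {fset nat * nat} :=
  if i is j.+1 then
    let S := wythoff_pairs j in
    let c := fresh S in
    S `|` [fset (c, (c + i)%N); ((c + i)%N, c)]
  else [fset (0, 0)].

Local Open Scope ring_scope.

Definition golden_ratio (R : realType) : R := (1 + Num.sqrt 5) / 2.

(* [Num.truncn x] is the floor of [x] as a natural number when [0 <= x]. *)
Definition wythoff_index (R : realType) (m : nat) : nat :=
  Num.truncn (m%:R / golden_ratio R).

(* Main.v *)
Require Import Defs.
From mathcomp Require Import all_boot all_order all_algebra.
From mathcomp Require Import finmap.
From mathcomp Require Import classical_sets reals.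
From mathcomp Require Import boolp zify ring lra.

(** The coordinates of the i-th pair are [floor (i phi)] and [floor (i phi^2)],
    because by Beatty's theorem ([1/phi + 1/phi^2 = 1]) these two sequences
    partition the positive integers.  Let [a phi < m < (a + 1) phi]; then
    [floor (i phi) < m] iff [i <= a], and [floor (i phi^2) < m] iff [i + a < m].
    A move of type II between pairs of indices [j < i <= a] can only go from
    [(c_i, c_i + i)] to [(c_j + j, c_j)] (up to symmetry) with [i + j = m]; but
    then [c_j + j >= m > c_i].  A position whose smaller pile is not a
    coordinate of these pairs has both piles of size at least [m], and as the
    differences [-a, ..., a] cover all residues mod [m], some pair of index at
    most [a] and with both coordinates below [m] can be reached, or some
    [(c_r, c_r + r)] with [r] the residue of the difference of the piles. *)

Import Order.TTheory GRing.Theory Num.Theory.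

Local Open Scope classical_set_scope.

(** * Independent absorbing sets in a terminating game *)

Section Kernel.
Variables (T : Type) (move : T -> T -> Prop) (size : T -> nat) (S : T -> Prop).
Hypothesis move_size : forall p q, move p q -> size q < size p.
Hypothesis S_independent : forall p q, S p -> move p q -> ~ S q.
Hypothesis S_absorbing : forall p, ~ S p -> exists2 q, move p q & S q.

(** From outside [S] the opponent could enter [S] at some [q]; by induction along the strategy the
    answer [sigma q] lies in [S] as well, against independence. Conversely, always answering with a
    move back into [S] wins, because sizes decrease. *)
Lemma P_position_kernel p : P_position move p <-> S p.
Proof.
split=> [[sigma]|Sp].
  elim=> {}p legal _ IH; apply: contrapT => /S_absorbing[q pq Sq].
  exact: S_independent Sq (legal q pq) (IH q pq).
(* For [q] in [S] the answer is an arbitrary default; it is never played, since every move from [S]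
   leaves [S]. *)
have answer q : exists r, ~ S q -> move q r /\ S r.
  have [Sq|/S_absorbing[r qr Sr]] := pselect (S q); first by exists q.
  by exists r.
have [sigma sigmaP] := choice answer.
exists sigma; have [n] := ubnP (size p).
elim: n p Sp => [|n IH] p Sp.
  by rewrite ltn0.
move=> pn; split=> q pq;
  have [qr Sr] := sigmaP q (S_independent p q Sp pq).
  exact: qr.
apply: (IH _ Sr); apply: leq_trans (move_size q _ qr) _.
exact: ltnW (leq_trans (move_size p q pq) pn).
Qed.

End Kernel.

(** * The golden ratio and Beatty's theorem for phi and phi^2 *)

Section GoldenBeatty.
Variable R : realType.
Local Open Scope ring_scope.
Local Notation phi := (golden_ratio R).

Lemma golden_ratio_sqr : phi * phi = phi + 1.
Proof.
have := sqr_sqrtr (ler0n R 5); rewrite expr2 /golden_ratio.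
set s := Num.sqrt _; nra.
Qed.

Lemma golden_ratio_gt1 : 1 < phi.
Proof.
have s1 : 1 < Num.sqrt 5 :> R by rewrite -[ltLHS]sqrtr1 ltr_sqrt ?ltr1n.
rewrite /golden_ratio; lra.
Qed.

Lemma golden_ratio_lt2 : phi < 2.
Proof. have := golden_ratio_sqr; have := golden_ratio_gt1; nra. Qed.

(** Since phi^2 = phi + 1, this is multiplication of x phi < y by phi; it trades a bound on one
    Beatty sequence for a bound on the other. *)
Lemma ltr_golden (x y : R) : (x * phi + x < y * phi) = (x * phi < y).
Proof.
have -> : x * phi + x = x * phi * phi by rewrite -mulrA golden_ratio_sqr; ring.
by rewrite ltr_pM2r //; have := golden_ratio_gt1; lra.
Qed.

Lemma gtr_golden (x y : R) : (y * phi < x * phi + x) = (y < x * phi).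
Proof.
have -> : x * phi + x = x * phi * phi by rewrite -mulrA golden_ratio_sqr; ring.
by rewrite ltr_pM2r //; have := golden_ratio_gt1; lra.
Qed.

(** Infinite descent: for i > 0 the equation makes n / i a root of x^2 = x + 1, and it passes from
    (n, i) to the smaller pair (i, n - i). *)
Lemma golden_equation_descent (n i : nat) :
  (n * n = n * i + i * i)%N -> i = 0%N.
Proof.
have [k] := ubnP n; elim: k n i => // k IH n i nk E.
case: (posnP i) => // i0.
have ni : (i < n)%N by nia.
have : (n - i = 0)%N by apply: (IH i); nia.
lia.
Qed.

Lemma golden_ratio_irrational (n i : nat) :
  (0 < i)%N -> n%:R != i%:R * phi.
Proof.
move=> i0; apply/eqP => E; suff : i = 0%N by lia.
apply: (@golden_equation_descent n); apply/eqP.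
rewrite -(eqr_nat R) natrD !natrM; apply/eqP.
have := golden_ratio_sqr; rewrite E => phi2.
by rewrite mulrACA phi2; ring.
Qed.

Definition lower (i : nat) : nat := Num.truncn (i%:R * phi).
(** As phi^2 = phi + 1, this is the floor of i phi^2. *)
Definition upper (i : nat) : nat := (lower i + i)%N.

Lemma lower_itv i : (lower i)%:R <= i%:R * phi < (lower i)%:R + 1.
Proof.
rewrite natr1; apply: truncn_itv; rewrite mulr_ge0 ?ler0n //; have := golden_ratio_gt1; lra.
Qed.

Lemma lower_itv_strict i : (0 < i)%N ->
  (lower i)%:R < i%:R * phi < (lower i)%:R + 1.
Proof.
move=> i0; have /andP[lo ->] := lower_itv i.
by rewrite lt_neqAle lo golden_ratio_irrational.
Qed.

Lemma lower_eq n i : n%:R <= i%:R * phi < n%:R + 1 -> lower i = n.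
Proof. by rewrite natr1 => /truncn_def. Qed.

Lemma lower0 : lower 0 = 0%N.
Proof. by apply: lower_eq; rewrite mul0r lexx add0r ltr01. Qed.

Lemma lower_mono : {mono lower : i j / (i <= j)%N}.
Proof.
apply: leq_mono => i j ij.
have := lower_itv i; have := lower_itv j.
have : i%:R + 1 <= j%:R :> R by rewrite natr1 ler_nat.
move=> ijR /andP[_ hj] /andP[hi _]; rewrite -(ltr_nat R).
have phi1 := golden_ratio_gt1.
rewrite -(ltrD2r 1) (le_lt_trans _ hj) //.
have : (i%:R + 1) * phi <= j%:R * phi by rewrite ler_wpM2r //; lra.
lra.
Qed.

Lemma upper_mono : {mono upper : i j / (i <= j)%N}.
Proof.
apply: leq_mono => i j ij; rewrite /upper -addnS leq_add // lower_mono.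
exact: ltnW.
Qed.

(** A common value n would satisfy n < i phi < n + 1 and n < j phi^2 < n + 1. Dividing by phi and by
    phi^2 and adding gives n < i + j < n + 1. *)
Lemma lower_neq_upper i j : (0 < j)%N -> lower i <> upper j.
Proof.
move=> j0 E; have i0 : (0 < i)%N.
  by case: i E => //; rewrite lower0 /upper; lia.
have := lower_itv_strict i i0; have := lower_itv_strict j j0.
move: (golden_ratio_gt1) (golden_ratio_sqr) => phi1 phi2.
set n := lower i in E *.
have -> : (lower j)%:R = n%:R - j%:R :> R by rewrite E /upper natrD addrK.
move=> /andP[j1 j2] /andP[i1 i2].
have iE : i%:R * (phi * phi) = i%:R * phi + i%:R by rewrite phi2; ring.
have jE : j%:R * (phi * phi) = j%:R * phi + j%:R by rewrite phi2; ring.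
have lo : n%:R * phi < (i + j)%:R * phi.
  by rewrite natrD; nra.
have hi : (i + j)%:R * phi < n.+1%:R * phi.
  by rewrite natrD -natr1; nra.
rewrite !ltr_pM2r ?ltr_nat in lo hi; first by lia.
all: lra.
Qed.

Lemma wythoff_index_itv m : (0 < m)%N ->
  (wythoff_index R m)%:R * phi < m%:R < ((wythoff_index R m)%:R + 1) * phi.
Proof.
move=> m0; have phi1 := golden_ratio_gt1; have phi0 : 0 < phi by lra.
have : (wythoff_index R m)%:R <= m%:R / phi < (wythoff_index R m).+1%:R.
  by apply: truncn_itv; rewrite divr_ge0 ?ler0n ?ltW.
rewrite ler_pdivlMr // ltr_pdivrMr // -natr1 => /andP[lo ->].
rewrite lt_neqAle lo !andbT; case: (posnP (wythoff_index R m)) => [->|a0].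
  by rewrite mul0r eq_sym pnatr_eq0 -lt0n.
by rewrite eq_sym golden_ratio_irrational.
Qed.

Lemma wythoff_index_lt m : (0 < m)%N -> (wythoff_index R m < m)%N.
Proof.
move=> m0; rewrite -(ltr_nat R).
have /andP[lo _] := wythoff_index_itv m m0; apply: le_lt_trans lo.
by rewrite ler_peMr ?ler0n // ltW // golden_ratio_gt1.
Qed.

(** For n > 0 let a be the floor of n / phi, so that (a + 1) phi is the first multiple of phi above
    n. Either it lies below n + 1, and n is [lower a.+1], or no multiple falls in between, and n is
    [upper (n - a)]. *)
Lemma lower_or_upper n : exists i, n = lower i \/ n = upper i.
Proof.
case: (posnP n) => [->|n0]; first by exists 0%N; left; rewrite lower0.
have /andP[] := wythoff_index_itv n n0; set a := wythoff_index R n => lo hi.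
have an : (a <= n)%N := ltnW (wythoff_index_lt n n0).
have := golden_ratio_irrational n.+1 a.+1 isT; rewrite -!natr1.
have [small _|big _|//] := ltgtP ((a%:R + 1) * phi) (n%:R + 1).
- by exists a.+1; left; apply/esym/lower_eq; rewrite -natr1 small ltW.
- exists (n - a)%N; right; rewrite /upper (lower_eq a) ?subnKC //.
  (* Multiplied by phi, the two bounds become a < (n - a) phi < a + 1. *)
  rewrite -ltr_golden in lo; rewrite -gtr_golden in big.
  by rewrite natrB //; apply/andP; split; lra.
Qed.

(** * Comparison of the two Beatty sequences with m *)

Section Index.
Variables (m : nat) (m_gt0 : (0 < m)%N).
Local Notation a := (wythoff_index R m).

Lemma lower_index : (lower a < m)%N.
Proof.
rewrite -(ltr_nat R); have /andP[lo _] := lower_itv a.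
by have /andP[+ _] := wythoff_index_itv m m_gt0; apply: le_lt_trans.
Qed.

Lemma lower_indexS : (m <= lower a.+1)%N.
Proof.
rewrite -ltnS -(ltr_nat R) -natr1; have /andP[_] := lower_itv a.+1.
by have /andP[_] := wythoff_index_itv m m_gt0; rewrite natr1; apply: lt_trans.
Qed.

(** From m < (a + 1) phi < 2 (a + 1). Hence the 2a + 1 differences -a, ..., a meet every residue mod
    m. *)
Lemma leq_double_index : (m <= a + a.+1)%N.
Proof.
rewrite -ltnS -(ltr_nat R) -!natr1 natrD -natr1.
have /andP[_] := wythoff_index_itv m m_gt0.
have : 0 <= a%:R :> R by [].
have := golden_ratio_lt2; nra.
Qed.

(** Put x = m - i. Multiplied by phi, x phi < m becomes m < i phi^2, and x phi > m becomes i phi^2 <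
    m; the cases x <= a and x >= a + 1 decide between them. *)
Lemma leq_upper_index i : (m <= upper i)%N = (m <= i + a)%N.
Proof.
have phi0 : 0 <= phi by have := golden_ratio_gt1; lra.
have /andP[alo ahi] := wythoff_index_itv m m_gt0.
have /andP[lo hi] := lower_itv i.
set x : R := m%:R - i%:R.
have [le_ia|] := leqP m (i + a).
  have xa : x * phi <= a%:R * phi.
    by rewrite ler_wpM2r // lerBlDl -natrD ler_nat.
  have : x * phi < m%:R by apply: le_lt_trans alo.
  rewrite -ltr_golden /x => ?.
  by rewrite -ltnS -(ltr_nat R) -natr1 natrD; lra.
move=> lt_im; have xa : (a%:R + 1) * phi <= x * phi.
  by rewrite ler_wpM2r // lerBrDl natr1 -natrD ler_nat addnS.
have : m%:R < x * phi by apply: lt_le_trans xa.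
rewrite -gtr_golden /x => ?; apply/negbTE; rewrite -ltnNge -(ltr_nat R) natrD; lra.
Qed.

End Index.

End GoldenBeatty.

(** * The recursive pairs as pairs of Beatty values *)

Section Pairs.
Variable R : realType.
Local Notation lower := (lower R).
Local Notation upper := (upper R).
Local Open Scope fset_scope.

Definition beatty_pair (n : nat) (p : nat * nat) : Prop :=
  exists2 i, i <= n & p = (lower i, upper i) \/ p = (upper i, lower i).

(** Monotonicity and disjointness make [lower n.+1] fresh. A smaller number c is [lower i] or
    [upper i] for some i, and then [lower i <= c < lower n.+1] forces i <= n. *)
Lemma fresh_beatty (S : {fset nat * nat}) n :
  (forall p, p \in S <-> beatty_pair n p) -> fresh S = lower n.+1.
Proof.
move=> memS.
have coordP c : c \in coordinates S <->
    exists2 i, i <= n & c = lower i \/ c = upper i.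
  rewrite /coordinates inE; split.
    case/orP => /imfsetP[p /= /memS[i le_in pE] ->];
      exists i => //; case: pE => ->; by [left | right].
  move=> [i le_in cE]; apply/orP; left; apply/imfsetP => /=.
  case: cE => ->; [exists (lower i, upper i)|exists (upper i, lower i)] => //;
    by apply/memS; exists i => //; by [left | right].
rewrite /fresh; case: ex_minnP => c /andP[c0 cS] min_c.
apply/eqP; rewrite eqn_leq; apply/andP; split.
  apply: min_c; apply/andP; split.
    by rewrite -(lower0 R) (leqW_mono (lower_mono R)).
  apply/negP => /coordP[i le_in [E|E]].
    by have := lower_mono R n.+1 i; rewrite E leqnn; lia.
  (* Index 0 is treated apart because [lower 0] and [upper 0] coincide. *)
  have [i0|i0] := posnP i; last exact: lower_neq_upper E.
  have := lower_mono R n.+1 0; rewrite E i0 /upper lower0; lia.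
rewrite leqNgt; apply: contra cS => c_lt; apply/coordP.
have [i cE] := lower_or_upper R c; exists i => //.
rewrite -ltnS -(leqW_mono (lower_mono R)); apply: leq_ltn_trans c_lt.
by case: cE => ->; rewrite // leq_addr.
Qed.

Lemma mem_wythoff_pairs n p : p \in wythoff_pairs n <-> beatty_pair n p.
Proof.
elim: n p => [|n IH] p /=.
  rewrite inE; split=> [/eqP ->|[i]].
    by exists 0; rewrite // /upper lower0; left.
  by rewrite leqn0 => /eqP ->; rewrite /upper lower0 => -[] ->.
rewrite (fresh_beatty _ _ IH) !inE -/(upper n.+1); split.
  case/orP => [/IH[i le_in pE]|/orP[]/eqP pE].
  - by exists i => //; apply: leqW.
  - by exists n.+1 => //; left.
  - by exists n.+1 => //; right.
move=> [i]; rewrite leq_eqVlt => /predU1P[->|le_in] pE.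
  by case: pE => ->; rewrite eqxx ?orbT.
by apply/orP; left; apply/IH; exists i.
Qed.

End Pairs.

(** * Moves described by their end positions, with the congruence free of truncated subtraction *)

Lemma wythoff_moveP m p1 p2 q1 q2 :
  wythoff_move m (p1, p2) (q1, q2) <->
  [\/ q1 < p1 /\ q2 = p2, q1 = p1 /\ q2 < p2 |
      [/\ q1 < p1, q2 < p2 & p1 + q2 = p2 + q1 %[mod m]]].
Proof.
split.
  move E: (p1, p2) => p; move F: (q1, q2) => q pq.
  case: pq E F => [r1 r2 k|r1 r2 k|r1 r2 k1 k2] => [k0 kr|k0 kr|k10 kr1 k20 kr2 kE]
    [-> ->] [-> ->]; [apply: Or31|apply: Or32|apply: Or33].
  - by split=> //; lia.
  - by split=> //; lia.
  split; [lia|lia|].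
  rewrite -{1}(subnK kr1) -{2}(subnK kr2).
  rewrite addnAC [in RHS]addnAC [in RHS](addnC (r2 - k2)).
  by apply/eqP; rewrite eqn_modDl kE.
case=> [[q1p ->]|[-> q2p]|[q1p q2p E]].
- have -> : q1 = p1 - (p1 - q1) by lia.
  by apply: TakeFirst; lia.
- have -> : q2 = p2 - (p2 - q2) by lia.
  by apply: TakeSecond; lia.
have -> : q1 = p1 - (p1 - q1) by lia.
have -> : q2 = p2 - (p2 - q2) by lia.
apply: TakeBoth; try lia.
apply/eqP; rewrite -(eqn_modDr (q1 + q2)).
have -> : p1 - q1 + (q1 + q2) = p1 + q2 by lia.
have -> : p2 - q2 + (q1 + q2) = p2 + q1 by lia.
exact/eqP.
Qed.

Lemma wythoff_moveC m p1 p2 q1 q2 :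
  wythoff_move m (p1, p2) (q1, q2) -> wythoff_move m (p2, p1) (q2, q1).
Proof.
move=> /wythoff_moveP[[? ?]|[? ?]|[? ? ?]]; apply/wythoff_moveP.
- exact: Or32.
- exact: Or31.
- exact: Or33.
Qed.

Lemma wythoff_move_size m p q :
  wythoff_move m p q -> q.1 + q.2 < p.1 + p.2.
Proof.
by case: p q => [p1 p2] [q1 q2] /wythoff_moveP[[? ?]|[? ?]|[? ? _]] /=; lia.
Qed.

(** * The pairs of index at most a form an independent absorbing set *)

Section Game.
Variables (R : realType) (m : nat) (m_gt0 : 0 < m).
Local Notation lower := (lower R).
Local Notation upper := (upper R).
Local Notation a := (wythoff_index R m).
Local Notation pair := (beatty_pair R a).

Lemma beatty_pairC p1 p2 : pair (p1, p2) -> pair (p2, p1).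
Proof. by move=> [i le_ia [[-> ->]|[-> ->]]]; exists i => //; [right|left]. Qed.

Lemma beatty_pair_independent p q : pair p -> wythoff_move m p q -> ~ pair q.
Proof.
case: p q => [p1 p2] [q1 q2] p_pair.
wlog [i le_ia [-> ->]] : p1 p2 q1 q2 p_pair /
    exists2 i, i <= a & p1 = lower i /\ p2 = upper i.
  move=> IH; case: (p_pair) => i le_ia [[pE1 pE2]|[pE1 pE2]] pq q_pair.
    by apply: (IH _ _ _ _ p_pair _ pq q_pair); exists i.
  apply: (IH _ _ _ _ (beatty_pairC _ _ p_pair) _ (wythoff_moveC _ _ _ _ _ pq));
    last exact: beatty_pairC.
  by exists i.
have lowerM := leqW_mono (lower_mono R); have upperM := leqW_mono (upper_mono R).
have am := wythoff_index_lt R m m_gt0.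
move=> /wythoff_moveP pq [j le_ja [[q1E q2E]|[q1E q2E]]]; subst q1 q2.
  case: pq => [[lt E]|[E lt]|[lt _ E]].
  - by move: lt; rewrite lowerM -upperM E ltnn.
  - by move: lt; rewrite upperM -lowerM E ltnn.
  (* Same orientation: the differences of the two pairs agree mod m, and both lie below m, so the
     pairs coincide. *)
  have : j = i %[mod m].
    apply/eqP; rewrite -(eqn_modDl (lower i + lower j)); apply/eqP.
    by move: E; rewrite /upper; congr (_ = _ %[mod m]); lia.
  rewrite !modn_small; try lia.
  by move=> ij; move: lt; rewrite ij ltnn.
case: pq => [[lt E]|[E lt]|[lt _ E]].
- by move: lt E; rewrite /upper; lia.
- have [j0|j0] := posnP j; last by case: (lower_neq_upper R i j j0).
  have i0 : i = 0.
    by apply/eqP; rewrite -leqn0 -(lower_mono R) -E j0 /upper lower0.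
  by move: lt; rewrite i0 j0 /upper lower0.
have ji : j < i by rewrite -lowerM; apply: leq_ltn_trans lt; rewrite leq_addr.
have : m %| i + j.
  rewrite /dvdn -(mod0n m) -(eqn_modDl (lower i + lower j)) eq_sym.
  by move/eqP: E; rewrite /upper; congr (_ == _ %[mod m]); lia.
move=> /dvdnP[k kE].
(* Here j < i <= a < m gives 0 < i + j < 2m. *)
have ijE : i + j = m by case: k kE => [|[|k]]; rewrite ?mulSn; lia.
have := lower_index R m m_gt0; have := lower_mono R i a.
have := leq_upper_index R m m_gt0 j; lia.
Qed.

Lemma beatty_pair_absorbing p :
  ~ pair p -> exists2 q, wythoff_move m p q & pair q.
Proof.
case: p => p1 p2; wlog le_p : p1 p2 / p1 <= p2.
  move=> IH np; have [le_p|/ltnW le_p] := leqP p1 p2; first exact: IH.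
  have [|[q1 q2] pq q_pair] := IH p2 p1 le_p.
    by move=> /beatty_pairC.
  by exists (q2, q1); [apply: wythoff_moveC|apply: beatty_pairC].
move=> np; have lowerM := leqW_mono (lower_mono R).
have [i p1E] := lower_or_upper R p1; have [le_ia|lt_ai] := leqP i a.
  have pair_i : pair (lower i, upper i) by exists i => //; left.
  case: p1E => p1E; subst p1.
    have [lt_p2|gt_p2|p2E] := ltngtP p2 (upper i).
    (* Taking equal numbers from both piles keeps the difference t < i, which is that of the pair of
       index t. *)
    - have [t tE] : exists t, p2 = lower i + t by exists (p2 - lower i); lia.
      have ti : t < i by move: lt_p2; rewrite tE /upper ltn_add2l.
      exists (lower t, upper t); last by exists t; [lia|left].
      apply/wythoff_moveP/Or33; split; first by rewrite lowerM.
        by rewrite tE /upper ltn_add2r lowerM.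
      by congr (_ %% _); rewrite tE /upper; lia.
    - by exists (lower i, upper i) => //; apply/wythoff_moveP/Or32.
    - by case: np; rewrite p2E.
  exists (upper i, lower i); last exact: beatty_pairC.
  apply/wythoff_moveP/Or32; split=> //.
  have le_i : lower i <= upper i by rewrite leq_addr.
  rewrite ltn_neqAle (leq_trans le_i le_p) andbT; apply/eqP => p2E.
  by apply: np; rewrite -p2E; apply: beatty_pairC.
(* For an index above a, both Beatty values are at least [lower a.+1], hence at least m. *)
have mp1 : m <= p1.
  apply: leq_trans (lower_indexS R m m_gt0) _.
  have : lower a.+1 <= lower i by rewrite lower_mono.
  by case: p1E => ->; rewrite /upper; lia.
have p2E : p2 = p1 + (((p2 - p1) %/ m) * m + (p2 - p1) %% m).
  by rewrite -divn_eq subnKC.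
have rm : (p2 - p1) %% m < m by rewrite ltn_mod.
move: ((p2 - p1) %/ m) ((p2 - p1) %% m) p2E rm => k r p2E rm.
have [le_ra|lt_ar] := leqP r a.
  (* Even if [upper r] exceeds m, the second pile suffices: [lower r < m <= p1] and r <= p2 - p1. *)
  have lo : lower r <= lower a by rewrite lower_mono.
  have lo' := lower_index R m m_gt0.
  exists (lower r, upper r); last by exists r => //; left.
  apply/wythoff_moveP/Or33; split; [lia|rewrite /upper; lia|].
  rewrite -[LHS](modnMDl k); congr (_ %% _); rewrite p2E /upper; lia.
(* Now r > a is represented by the difference -(m - r): m <= 2a + 1 gives m - r <= a, and (m - r) +
   a < m gives [upper (m - r) < m]. *)
have ma := leq_double_index R m m_gt0.
have := leq_upper_index R m m_gt0 (m - r) => up.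
have {}up : upper (m - r) < m by lia.
exists (upper (m - r), lower (m - r)); last by exists (m - r); [lia|right].
apply/wythoff_moveP/Or33; split; [lia|move: up; rewrite /upper; lia|].
rewrite -[LHS](modnMDl k.+1); congr (_ %% _); rewrite p2E /upper mulSn; lia.
Qed.

End Game.

Theorem theorem5 (R : realType) (m : nat) (hm : 0 < m) :
  [set p | P_position (wythoff_move m) p]
  = [set` wythoff_pairs (wythoff_index R m)].
Proof.
have kernel := P_position_kernel _ _ _ _ (wythoff_move_size m)
  (beatty_pair_independent R m hm) (beatty_pair_absorbing R m hm).
apply/seteqP; split=> p /=; first by move/kernel/mem_wythoff_pairs.
by move/(mem_wythoff_pairs R)/kernel.
Qed.
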